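(* Let $q,\lambda\in\mathbb C^*$, $\alpha\in\mathbb C$, $\beta=(\beta_1,\beta_2)\in\mathbb C^2$, $\gamma=(\gamma_1,\gamma_2)\in\mathbb C^2$ and $\mathbf h(\alpha)\in\mathcal T_\alpha$. The $\mathcal B(q)$-module $\Omega(\lambda,\alpha,\beta,\gamma,\mathbf h(\alpha))$ is simple if and only if either $\alpha\neq0$, or ($q=-1$ and $\beta_1\neq0$).
   Context: $\mathbb N=\{0,1,2,\dots\}$, $\mathbb C^*=\mathbb C\setminus\{0\}$. For $q\in\mathbb C^*$, the Takiff Block type Lie algebra $\mathcal B(q)$ is the complex Lie algebra with basis $\{L_{m,i},W_{m,i},C_1,C_2\mid (m,i)\in\mathbb Z\times\mathbb N\}$, with $C_1,C_2$ central and $[L_{m,i},L_{n,j}]=(n(i+q)-m(j+q))L_{m+n,i+j}+\frac{m^3-m}{12}\delta_{i+j,0}\delta_{m+n,0}C_1$, $[L_{m,i},W_{n,j}]=(n(i+q)-m(j+q))W_{m+n,i+j}+\frac{m^3-m}{12}\delta_{i+j,0}\delta_{m+n,0}C_2$, $[W_{m,i},W_{n,j}]=0$. For $k\in\mathbb N$, $n\in\mathbb Z$, $\alpha\in\mathbb C$ put $h_{n,k;\alpha}(t)=nt^k-n(n-1)\alpha\frac{t^k-\alpha^k}{t-\alpha}\in\mathbb C[t]$. $\mathcal T_\alpha$ is the set of all families $\mathbf h=\{h_m(t)\mid m\in\mathbb Z\}$ of polynomials of the form $h_m(t)=\sum_{i\ge0}\xi_ih_{m,i;\alpha}(t)$ with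 $\xi_i\in\mathbb C$ independent of $m$ and all but finitely many zero. For $\mathbf h\in\mathcal T_\alpha$ and $c\in\mathbb C$ put $\Theta_{\mathbf h,c}(t)=c\,\frac{h_1(-t)-h_1(\alpha)}{-t-\alpha}\in\mathbb C[t]$. The $\mathcal B(q)$-module $\Omega(\lambda,\alpha,\beta,\gamma,\mathbf h(\alpha))$ is $\mathbb C[t,s]$ with $C_1,C_2$ acting by $0$ and, for $(m,i)\in\mathbb Z\times\mathbb N$, $L_{m,i}f(t,s)=\delta_{i,0}\lambda^m(s+qh_m(q^{-1}t))f(t,s-mq)-\delta_{i,0}m\lambda^mq(t-mq\alpha)\frac{\partial}{\partial t}f(t,s-mq)+\delta_{m,0}\delta_{i,-2q}\gamma_2f(t,s)+\delta_{i,1}\delta_{q,-1}\lambda^m\big(\beta_2+m\Theta_{\mathbf h,\beta_1}(t)+m\beta_1\frac{\partial}{\partial t}\big)f(t,s+m)$, $W_{m,i}f(t,s)=\delta_{i,0}\lambda^m(t-mq\alpha)f(t,s-mq)+\delta_{m,0}\delta_{i,-2q}\gamma_1f(t,s)+\delta_{i,1}\delta_{q,-1}\beta_1\lambda^mf(t,s+m)$. *)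

(* Defs.v *)
From HB Require Import structures.
From mathcomp Require Import all_boot all_order all_algebra.
From mathcomp Require Import finmap monalg ring.
From mathcomp Require Import complex reals.

Set Implicit Arguments.
Unset Strict Implicit.
Unset Printing Implicit Defensive.

Import Order.TTheory GRing.Theory Num.Theory.
Local Open Scope ring_scope.

HB.mixin Record Lmodule_isLie (K : fieldType) L of GRing.Lmodule K L := {
  lie : L -> L -> L;
  lie_linearl : forall y, linear (fun x => lie x y);
  lie_linearr : forall x, linear (lie x);
  liexx : forall x, lie x x = 0;
  lie_jacobi : forall x y z,
    lie x (lie y z) + lie y (lie z x) + lie z (lie x y) = 0
}.

#[short(type="lieAlgType")]
HB.structure Definition LieAlg (K : fieldType) :=
  { L of Lmodule_isLie K L & GRing.Lmodule K L }.

Record lieModule (K : fieldType) (L : lieAlgType K) := LieModule {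
  module_sort :> lmodType K;
  act : L -> module_sort -> module_sort;
  act_linearl : forall v, linear (fun x => act x v);
  act_linearr : forall x, linear (act x);
  act_lie : forall x y v, act (lie x y) v = act x (act y v) - act y (act x v)
}.

Definition submodule (K : fieldType) (L : lieAlgType K) (M : lieModule L)
    (N : M -> Prop) : Prop :=
  [/\ N 0,
      forall u v, N u -> N v -> N (u + v),
      forall (c : K) v, N v -> N (c *: v) &
      forall x v, N v -> N (act x v)].

Definition simple_module (K : fieldType) (L : lieAlgType K) (M : lieModule L) :
    Prop :=
  (exists v : M, v <> 0) /\
  forall N : M -> Prop, submodule N ->
    (forall v, N v -> v = 0) \/ (forall v, N v).

(* [linext] and [bvec] are locked because unifying two distinct basis vectors
   would otherwise unfold the finite maps underlying [{malg K[I]}]. *)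
HB.lock Definition linext (K : fieldType) (I : choiceType) (V : lmodType K)
    (F : I -> V) (x : {malg K[I]}) : V :=
  \sum_(k <- msupp x) x@_k *: F k.

HB.lock Definition bvec (K : fieldType) (I : choiceType) (k : I) :
  {malg K[I]} := << k >>.

Section LinExt.
Variables (K : fieldType) (I : choiceType) (V : lmodType K).
Local Notation "<| k |>" := (bvec K k) (at level 0).

Lemma linextw (F : I -> V) (x : {malg K[I]}) (d : {fset I}) :
  (msupp x `<=` d)%fset -> linext F x = \sum_(k <- d) x@_k *: F k.
Proof.
move=> sxd; rewrite linext.unlock (big_fset_incl _ sxd) // => k _.
by rewrite -mcoeff_eq0 => /eqP ->; rewrite scale0r.
Qed.

Lemma linext_linear (F : I -> V) : linear (linext F).
Proof.
move=> c x y.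
pose d := (msupp x `|` msupp y)%fset.
have sx : (msupp x `<=` d)%fset by apply: fsubsetUl.
have sy : (msupp y `<=` d)%fset by apply: fsubsetUr.
have sc : (msupp (c *: x + y) `<=` d)%fset.
  apply: fsubset_trans (msuppD_le _ _) _; rewrite fsubUset sy andbT.
  exact: fsubset_trans (msuppZ_le _ _) sx.
rewrite (linextw F sx) (linextw F sy) (linextw F sc) scaler_sumr -big_split /=.
by apply: eq_bigr => k _; rewrite mcoeffD mcoeffZ scalerDl scalerA.
Qed.

HB.instance Definition _ (F : I -> V) :=
  GRing.isLinear.Build K {malg K[I]} V *:%R (linext F) (linext_linear F).

Lemma linextU (F : I -> V) k : linext F <| k |> = F k.
Proof. by rewrite linext.unlock bvec.unlock msuppU oner_eq0 big_seq_fset1 mcoeffUU scale1r. Qed.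

Lemma linext_linearF c (F G : I -> V) x :
  linext (fun k => c *: F k + G k) x = c *: linext F x + linext G x.
Proof.
rewrite linext.unlock scaler_sumr -big_split /=; apply: eq_bigr => k _.
by rewrite scalerDr !scalerA mulrC.
Qed.

Lemma eq_linext (F G : I -> V) : F =1 G -> linext F =1 linext G.
Proof. by move=> FG x; rewrite linext.unlock; apply: eq_bigr => k _; rewrite FG. Qed.


Lemma malg_linE (f : {linear {malg K[I]} -> V}) x :
  f x = \sum_(k <- msupp x) x@_k *: f <| k |>.
Proof.
rewrite {1}(monalgE x) raddf_sum; apply: eq_bigr => k _.
have -> : << x@_k *g k >> = x@_k *: <| k |> :> {malg K[I]}.
  by rewrite bvec.unlock; apply/malgP => k'; rewrite mcoeffZ !mcoeffU mulrnAr mulr1.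
exact: linearZZ.
Qed.

Lemma malg_lin_eq (f g : {malg K[I]} -> V) : linear f -> linear g ->
  (forall k, f <| k |> = g <| k |>) -> f =1 g.
Proof.
move=> lf lg fg x.
pose Lf := GRing.isLinear.Build K {malg K[I]} V *:%R f lf.
pose Lg := GRing.isLinear.Build K {malg K[I]} V *:%R g lg.
pose f' : {linear {malg K[I]} -> V} := HB.pack f Lf.
pose g' : {linear {malg K[I]} -> V} := HB.pack g Lg.
rewrite [LHS](malg_linE f') [RHS](malg_linE g'); apply: eq_bigr => k _.
by rewrite /= fg.
Qed.

End LinExt.

Inductive block_index : Type :=
  Lb of int & nat | Wb of int & nat | C1b | C2b.

Definition block_index_code (b : block_index) :
    (int * nat) + (int * nat) + bool :=
  match b with
  | Lb m i => inl (inl (m, i))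
  | Wb m i => inl (inr (m, i))
  | C1b => inr true
  | C2b => inr false
  end.

Definition block_index_decode (x : (int * nat) + (int * nat) + bool) :=
  match x with
  | inl (inl (m, i)) => Lb m i
  | inl (inr (m, i)) => Wb m i
  | inr true => C1b
  | inr false => C2b
  end.

Lemma block_index_codeK : cancel block_index_code block_index_decode.
Proof. by case. Qed.

HB.instance Definition _ :=
  Countable.copy block_index (can_type block_index_codeK).

Lemma eqrN_eq0 (K : numFieldType) (V : lmodType K) (x : V) : x = - x -> x = 0.
Proof.
move/eqP; rewrite -addr_eq0 -mulr2n -scaler_nat scaler_eq0.
by rewrite pnatr_eq0 => /eqP.
Qed.

Lemma addr3ACA (V : zmodType) (a b c d e f : V) :
  a + d + (b + e) + (c + f) = a + b + c + (d + e + f).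
Proof. by rewrite (addrACA a d) [LHS]addrACA. Qed.

Section Block.
Variable K : numFieldType.
Local Notation "<| k |>" := (bvec K k) (at level 0).

Definition Block (q : K) : Type := {malg K[block_index]}.

HB.instance Definition _ (q : K) :=
  GRing.Lmodule.copy (Block q) {malg K[block_index]}.

Variable q : K.

(* The coefficient n(i+q) - m(j+q) and the central coefficient in
   [L_{m,i}, L_{n,j}] and [L_{m,i}, W_{n,j}]. *)
Definition block_coef (m : int) (i : nat) (n : int) (j : nat) : K :=
  n%:~R * (i%:R + q) - m%:~R * (j%:R + q).

Definition block_cocycle (m : int) (i : nat) (n : int) (j : nat) : K :=
  (m%:~R ^+ 3 - m%:~R) / 12%:R *+ (i + j == 0)%N *+ (m + n == 0).

Lemma block_cocycle_jacobi m i n j p k :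
  block_coef n j p k * block_cocycle m i (n + p) (j + k)
  - block_coef m i p k * block_cocycle n j (m + p) (i + k)
  = block_coef m i n j * block_cocycle (m + n) (i + j) p k.
Proof.
rewrite /block_cocycle !addnA [(j + i)%N]addnC !addrA [n + m]addrC.
case: (boolP (i + j + k == 0)%N) => [|_]; last first.
  by rewrite !mulr0n !mul0rn !mulr0 subrr.
rewrite !addn_eq0 => /andP[/andP[/eqP-> /eqP->] /eqP->].
case: (boolP (m + n + p == 0)) => [|_]; last first.
  by rewrite !mulr0n !mulr0 subrr.
rewrite addrC addr_eq0 => /eqP ->; rewrite !mulr1n /block_coef.
by rewrite !(rmorphN, rmorphD) /=; field.
Qed.

Section JacobiCore.
Variables (V : lmodType K) (br : V -> V -> V).
Hypothesis br_linr : forall c u v w, br w (c *: u + v) = c *: br w u + br w v.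
Hypothesis brC : forall u v, br u v = - br v u.
Variables (L X : int -> nat -> V) (C D : V).
Hypothesis brL : forall m i n j, br (L m i) (L n j) =
  block_coef m i n j *: L (m + n) (i + j)%N + block_cocycle m i n j *: C.
Hypothesis brX : forall m i n j, br (L m i) (X n j) =
  block_coef m i n j *: X (m + n) (i + j)%N + block_cocycle m i n j *: D.
Hypothesis brD : forall m i, br (L m i) D = 0.
Hypothesis brXC : forall m i, br (X m i) C = 0.

Lemma jacobi_core m i n j p k :
  br (L m i) (br (L n j) (X p k)) + br (L n j) (br (X p k) (L m i))
  + br (X p k) (br (L m i) (L n j)) = 0.
Proof.
have br0 u : br u 0 = 0.
  by have := br_linr (-1) 0 0 u; rewrite scaler0 addr0 scaleN1r addNr.
have brZ c u v : br u (c *: v) = c *: br u v.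
  by rewrite -[c *: v]addr0 br_linr br0 addr0.
have brN u v : br u (- v) = - br u v by rewrite -scaleN1r brZ scaleN1r.
rewrite [br (X p k) (L m i)]brC brN !brX brL !br_linr !brZ !brD brXC.
rewrite [br (X p k) _]brC !brX !scaler0 !addr0 scalerN !scalerDr !scalerA.
rewrite addnA [(j + (i + k))%N]addnCA addnA !addrA [n + m]addrC.
rewrite !opprD -!scaleNr addr3ACA -!scalerDl block_cocycle_jacobi subrr.
rewrite scale0r addr0 /block_coef !(rmorphD, natrD) /=.
by rewrite -[RHS](scale0r (X (m + n + p) (i + j + k)%N)); congr (_ *: _); ring.
Qed.
End JacobiCore.

Definition block_bracket (a b : block_index) : Block q :=
  match a, b with
  | Lb m i, Lb n j =>
      block_coef m i n j *: <| Lb (m + n) (i + j) |>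
      + block_cocycle m i n j *: <| C1b |>
  | Lb m i, Wb n j =>
      block_coef m i n j *: <| Wb (m + n) (i + j) |>
      + block_cocycle m i n j *: <| C2b |>
  | Wb n j, Lb m i =>
      - (block_coef m i n j *: <| Wb (m + n) (i + j) |>
         + block_cocycle m i n j *: <| C2b |>)
  | _, _ => 0
  end.

Definition block_lie (x y : Block q) : Block q :=
  linext (fun a => linext (block_bracket a) y) x.

Lemma block_lie_linl c x y z :
  block_lie (c *: x + y) z = c *: block_lie x z + block_lie y z.
Proof. exact: linext_linear. Qed.

Lemma block_lie_linr c x y z :
  block_lie z (c *: x + y) = c *: block_lie z x + block_lie z y.
Proof.
rewrite /block_lie -linext_linearF; apply: eq_linext => a.
exact: linext_linear.
Qed.

Lemma block_lieU a b : block_lie <| a |> <| b |> = block_bracket a b.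
Proof. by rewrite /block_lie !linextU. Qed.

Lemma block_lie0l x : block_lie 0 x = 0.
Proof. by have := block_lie_linl (-1) 0 0 x; rewrite scaler0 addr0 scaleN1r addNr. Qed.

Lemma block_lie0r x : block_lie x 0 = 0.
Proof. by have := block_lie_linr (-1) 0 0 x; rewrite scaler0 addr0 scaleN1r addNr. Qed.

Lemma block_lieZl c x z : block_lie (c *: x) z = c *: block_lie x z.
Proof. by rewrite -[c *: x]addr0 block_lie_linl block_lie0l addr0. Qed.

Lemma block_lieZr c x z : block_lie z (c *: x) = c *: block_lie z x.
Proof. by rewrite -[c *: x]addr0 block_lie_linr block_lie0r addr0. Qed.

Lemma block_lieDr x y z : block_lie z (x + y) = block_lie z x + block_lie z y.
Proof. by rewrite -[x]scale1r block_lie_linr !scale1r. Qed.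

Lemma block_lieNr x z : block_lie z (- x) = - block_lie z x.
Proof. by rewrite -scaleN1r block_lieZr scaleN1r. Qed.

Lemma block_coefC m i n j : block_coef n j m i = - block_coef m i n j.
Proof. by rewrite /block_coef opprB. Qed.

Lemma block_cocycleC m i n j : block_cocycle n j m i = - block_cocycle m i n j.
Proof.
rewrite /block_cocycle [n + m]addrC [(j + i)%N]addnC.
case: (_ == 0)%N; last by rewrite !mulr0n !mul0rn oppr0.
case: eqP => [/eqP|_]; rewrite ?mulr0n ?oppr0 // !mulr1n.
by rewrite addr_eq0 => /eqP ->; rewrite rmorphN /=; field.
Qed.

Lemma block_bracketC a b : block_bracket a b = - block_bracket b a.
Proof.
case: a b => [m i|m i||] [n j|n j||] //=; rewrite ?opprK ?oppr0 //.
rewrite (block_coefC m i) (block_cocycleC m i) !scaleNr opprD !opprK.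
by rewrite (addrC n m) (addnC j i).
Qed.

Lemma block_lieC x y : block_lie x y = - block_lie y x.
Proof.
move: x; apply: malg_lin_eq => [c u v|c u v|a].
- exact: block_lie_linl.
- by rewrite block_lie_linr opprD scalerN.
move: y; apply: malg_lin_eq => [c u v|c u v|b].
- exact: block_lie_linr.
- by rewrite block_lie_linl opprD scalerN.
by rewrite !block_lieU block_bracketC.
Qed.

Lemma block_liexx x : block_lie x x = 0.
Proof. exact/eqrN_eq0/block_lieC. Qed.

Let jac (x y z : Block q) :=
  block_lie x (block_lie y z) + block_lie y (block_lie z x)
  + block_lie z (block_lie x y).

Let jac_rot x y z : jac x y z = jac y z x.
Proof. by rewrite /jac -[LHS]addrA [LHS]addrC. Qed.

Let jac_lin y z : linear (fun x => jac x y z).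
Proof.
move=> c u v; rewrite /jac !(block_lie_linl, block_lie_linr) !scalerDr.
exact: addr3ACA.
Qed.

Let jac0 a y z : block_lie <| a |> =1 (fun=> 0) -> jac <| a |> y z = 0.
Proof.
move=> a0; rewrite /jac a0 [block_lie z <| a |>]block_lieC !a0 oppr0.
by rewrite !block_lie0r !addr0.
Qed.

Let lieC1 : block_lie <| C1b |> =1 (fun=> 0).
Proof.
by apply: malg_lin_eq => [c u v|c u v|a];
  [exact: block_lie_linr|rewrite scaler0 addr0|rewrite block_lieU].
Qed.

Let lieC2 : block_lie <| C2b |> =1 (fun=> 0).
Proof.
by apply: malg_lin_eq => [c u v|c u v|a];
  [exact: block_lie_linr|rewrite scaler0 addr0|rewrite block_lieU].
Qed.

Let jacLLL m i n j p k : jac <| Lb m i |> <| Lb n j |> <| Lb p k |> = 0.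
Proof.
apply: (jacobi_core block_lie_linr block_lieC
  (L := fun m i => <| Lb m i |>) (X := fun m i => <| Lb m i |>)
  (C := <| C1b |>) (D := <| C1b |>)) => *; exact: block_lieU.
Qed.

Let jacLLW m i n j p k : jac <| Lb m i |> <| Lb n j |> <| Wb p k |> = 0.
Proof.
apply: (jacobi_core block_lie_linr block_lieC
  (L := fun m i => <| Lb m i |>) (X := fun m i => <| Wb m i |>)
  (C := <| C1b |>) (D := <| C2b |>)) => *; exact: block_lieU.
Qed.

Let lieWW m i n j : block_lie <| Wb m i |> <| Wb n j |> = 0.
Proof. exact: block_lieU. Qed.

Let lieWLW m i n j p k :
  block_lie <| Wb m i |> (block_lie <| Lb n j |> <| Wb p k |>) = 0.
Proof.
rewrite (block_lieU (Lb n j)) block_lieDr !block_lieZr lieWW.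
by rewrite (block_lieU _ C2b) !scaler0 addr0.
Qed.

Let jacWWL m i n j p k : jac <| Wb m i |> <| Wb n j |> <| Lb p k |> = 0.
Proof.
rewrite /jac (block_lieC <| Wb n j |> <| Lb p k |>) block_lieNr !lieWLW.
by rewrite lieWW block_lie0r oppr0 !addr0.
Qed.

Let jacWWW m i n j p k : jac <| Wb m i |> <| Wb n j |> <| Wb p k |> = 0.
Proof. by rewrite /jac !lieWW !block_lie0r !addr0. Qed.

Lemma block_lie_jacobi x y z :
  block_lie x (block_lie y z) + block_lie y (block_lie z x)
  + block_lie z (block_lie x y) = 0.
Proof.
have lin0 (V : lmodType K) : linear (fun _ : {malg K[block_index]} => 0 : V).
  by move=> c u v; rewrite scaler0 addr0.
suff : forall a b c, jac <| a |> <| b |> <| c |> = 0.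
  move=> jacU; rewrite -/(jac x y z).
  apply: (malg_lin_eq (jac_lin y z) (lin0 _) _ x) => a; rewrite jac_rot.
  apply: (malg_lin_eq (jac_lin z <| a |>) (lin0 _) _ y) => b; rewrite jac_rot.
  by apply: (malg_lin_eq (jac_lin <| a |> <| b |>) (lin0 _) _ z) => c;
    rewrite jac_rot.
case=> [m i|m i||]; [| |by move=> *; exact: jac0|by move=> *; exact: jac0].
- case=> [n j|n j||] b; rewrite jac_rot; [| |exact: jac0|exact: jac0].
  + rewrite jac_rot; case: b => [p k|p k||]; [| |exact: jac0|exact: jac0].
    * exact: jacLLL.
    * by rewrite jac_rot jacLLW.
  + case: b => [p k|p k||]; [| |by rewrite jac_rot jac0|by rewrite jac_rot jac0].
    * by rewrite jac_rot jacLLW.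
    * exact: jacWWL.
- case=> [n j|n j||] b; rewrite jac_rot; [| |exact: jac0|exact: jac0].
  + case: b => [p k|p k||]; [| |by rewrite jac_rot jac0|by rewrite jac_rot jac0].
    * exact: jacLLW.
    * by rewrite jac_rot jacWWL.
  + rewrite jac_rot; case: b => [p k|p k||]; [| |exact: jac0|exact: jac0].
    * by rewrite jac_rot jacWWL.
    * exact: jacWWW.
Qed.

End Block.

HB.instance Definition _ (K : numFieldType) (q : K) :=
  Lmodule_isLie.Build K (Block q)
    (fun y c x z => block_lie_linl c x z y) (fun x c y z => block_lie_linr c y z x)
    (@block_liexx K q) (@block_lie_jacobi K q).

Section Families.
Variable K : fieldType.

(* The quotients in [hpoly] and [Theta] are exact polynomial divisions. *)
Definition hpoly (alpha : K) (n : int) (k : nat) : {poly K} :=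
  n%:~R *: 'X^k
  - ((n * (n - 1))%:~R * alpha)
      *: (('X^k - (alpha ^+ k)%:P) %/ ('X - alpha%:P)).

Definition calT (alpha : K) (h : int -> {poly K}) : Prop :=
  exists (N : nat) (xi : nat -> K),
    forall m, h m = \sum_(i < N) xi i *: hpoly alpha m i.

Definition Theta (alpha : K) (h : int -> {poly K}) (c : K) : {poly K} :=
  c *: ((h 1 \Po (- 'X) - (h 1).[alpha]%:P) %/ (- 'X - alpha%:P)).

Lemma calT_factor alpha h : calT alpha h -> exists (c : K) (D : {poly K}),
  forall m, h m = m%:~R *: (c%:P + ('X - (m%:~R * alpha)%:P) * D).
Proof.
case=> N [xi hE].
pose D k : {poly K} := ('X^k - (alpha ^+ k)%:P) %/ ('X - alpha%:P).
have DE k : 'X^k = (alpha ^+ k)%:P + ('X - alpha%:P) * D k.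
  rewrite mulrC /D divpK; first by rewrite addrC subrK.
  by rewrite dvdp_XsubCl /root !hornerE subrr.
exists (\sum_(i < N) xi i * alpha ^+ i), (\sum_(i < N) xi i *: D i) => m.
rewrite hE rmorph_sum mulr_sumr -big_split scaler_sumr; apply: eq_bigr => i _.
rewrite /hpoly -/(D i) {1}DE -!mul_polyC !rmorphM /= rmorphB /=.
rewrite !rmorph_int.
by ring.
Qed.

End Families.

(* K[t,s], as polynomials in s with coefficients in K[t]; it is a copy of
   [{poly {poly K}}] carrying a K-linear rather than a K[t]-linear structure *)
Definition bipoly (K : fieldType) : Type := {poly {poly K}}.

HB.instance Definition _ (K : fieldType) :=
  GRing.ComNzRing.copy (bipoly K) {poly {poly K}}.

Section Bipoly.
Variable K : fieldType.
Implicit Types f g : bipoly K.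

Definition bconst (c : K) : bipoly K := c%:P%:P.

Lemma bconst_is_zmod_morphism : zmod_morphism bconst.
Proof. by move=> c d; rewrite /bconst !rmorphB. Qed.

Lemma bconst_is_monoid_morphism : monoid_morphism bconst.
Proof. by split=> [//|c d]; rewrite /bconst !rmorphM. Qed.

HB.instance Definition _ :=
  GRing.isZmodMorphism.Build K (bipoly K) bconst bconst_is_zmod_morphism.
HB.instance Definition _ :=
  GRing.isMonoidMorphism.Build K (bipoly K) bconst bconst_is_monoid_morphism.

Definition bscale (c : K) f : bipoly K := bconst c * f.

Lemma bscaleA a b f : bscale a (bscale b f) = bscale (a * b) f.
Proof. by rewrite /bscale rmorphM mulrA. Qed.

Lemma bscale1 : left_id 1 bscale.
Proof. by move=> f; rewrite /bscale rmorph1 mul1r. Qed.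

Lemma bscaleDr : right_distributive bscale +%R.
Proof. by move=> c f g; rewrite /bscale mulrDr. Qed.

Lemma bscaleDl f : {morph bscale^~ f : a b / a + b}.
Proof. by move=> a b; rewrite /bscale rmorphD mulrDl. Qed.

HB.instance Definition _ := GRing.Zmodule_isLmodule.Build K (bipoly K)
  bscaleA bscale1 bscaleDr bscaleDl.

Lemma bscaleE c f : c *: f = bconst c * f.
Proof. by []. Qed.

Definition bpoly (p : {poly K}) : bipoly K := p%:P.
Lemma bpolyC c : bpoly c%:P = bconst c.
Proof. by []. Qed.

Definition bs : bipoly K := 'X.

HB.instance Definition _ :=
  GRing.RMorphism.copy bpoly (polyC : {poly K} -> {poly {poly K}}).

(* f(t, s + a) *)
Definition bshift (a : K) f : bipoly K := f \Po ('X + a%:P%:P).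

(* partial derivative with respect to t *)
Definition bdt f : bipoly K := map_poly (fun p : {poly K} => p^`()) f.

Lemma bshift_is_zmod_morphism a : zmod_morphism (bshift a).
Proof. by move=> f g; rewrite /bshift rmorphB. Qed.

Lemma bshift_is_monoid_morphism a : monoid_morphism (bshift a).
Proof. by split=> [|f g]; rewrite /bshift (rmorph1, rmorphM). Qed.

HB.instance Definition _ a := GRing.isZmodMorphism.Build (bipoly K) (bipoly K)
  (bshift a) (bshift_is_zmod_morphism a).
HB.instance Definition _ a := GRing.isMonoidMorphism.Build (bipoly K) (bipoly K)
  (bshift a) (bshift_is_monoid_morphism a).

Lemma bshiftC a c : bshift a (bconst c) = bconst c.
Proof. exact: comp_polyC. Qed.

Lemma bshiftp a p : bshift a (bpoly p) = bpoly p.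
Proof. exact: comp_polyC. Qed.

Lemma bshifts a : bshift a bs = bs + bconst a.
Proof. exact: comp_polyX. Qed.

Lemma bshiftD a b f : bshift a (bshift b f) = bshift (a + b) f.
Proof.
rewrite /bshift -comp_polyA comp_polyD comp_polyX comp_polyC.
by rewrite -addrA -!rmorphD.
Qed.

Lemma bdtE f i : (bdt f : {poly {poly K}})`_i = ((f : {poly {poly K}})`_i)^`().
Proof. by rewrite /bdt coef_map_id0 // linear0. Qed.

Lemma bdt_is_zmod_morphism : zmod_morphism bdt.
Proof.
by move=> f g; apply/polyP => i; rewrite coefB !bdtE coefB linearB.
Qed.

HB.instance Definition _ := GRing.isZmodMorphism.Build (bipoly K) (bipoly K)
  bdt bdt_is_zmod_morphism.

Lemma bdtM f g : bdt (f * g) = bdt f * g + f * bdt g.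
Proof.
apply/polyP => i; rewrite coefD !bdtE !coefM linear_sum /= -big_split /=.
by apply: eq_bigr => j _; rewrite derivM !bdtE.
Qed.

Lemma bdtp p : bdt (bpoly p) = bpoly p^`().
Proof. by apply/polyP => i; rewrite bdtE !coefC; case: eqP; rewrite ?linear0. Qed.

Lemma bdtC c : bdt (bconst c) = 0.
Proof. by rewrite -[bconst c]/(bpoly c%:P) bdtp derivC rmorph0. Qed.

Lemma bdts : bdt bs = 0.
Proof.
by apply/polyP => i; rewrite bdtE coefX coef0; case: eqP => _;
  rewrite ?mulr1n ?mulr0n (derivC, linear0).
Qed.

Lemma bdt_shift a f : bdt (bshift a f) = bshift a (bdt f).
Proof.
elim/poly_ind: f => [|f p IH]; first by rewrite !raddf0.
rewrite -[f * 'X + p%:P]/((f : bipoly K) * bs + bpoly p).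
have -> : bshift a ((f : bipoly K) * bs + bpoly p)
          = bshift a f * (bs + bconst a) + bpoly p.
  by rewrite rmorphD rmorphM /= bshifts bshiftp.
have -> : bdt ((f : bipoly K) * bs + bpoly p) = bdt f * bs + bpoly p^`().
  by rewrite raddfD /= bdtM bdts bdtp mulr0 addr0.
rewrite raddfD /= bdtM IH raddfD /= bdts bdtC bdtp addr0 mulr0 addr0.
by rewrite rmorphD rmorphM /= bshifts bshiftp.
Qed.

End Bipoly.

Arguments bs {K}.

(* Operators into which the actions of L_{m,i} and W_{m,i} on Omega decompose,
   once every h_m is written m (c + (X - m alpha) D) with c and D independent
   of m; they are used only to check the module axioms. *)
Section OmegaOps.
Variables (K : numFieldType) (q lambda alpha b1 b2 c : K) (E : {poly K}).
Implicit Types f : bipoly K.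

Let t : bipoly K := bpoly 'X.
Let e : bipoly K := bpoly E.

Definition omega_A (m : int) f : bipoly K := bconst (lambda ^ m) *
  ((bs + bconst m%:~R * (bconst c + (t - bconst (m%:~R * q * alpha)) * e))
     * bshift (- (m%:~R * q)) f
   - bconst (m%:~R * q) * (t - bconst (m%:~R * q * alpha))
     * bdt (bshift (- (m%:~R * q)) f)).
Definition omega_B (m : int) f : bipoly K := bconst (lambda ^ m) *
  ((bconst b2 + bconst (m%:~R * b1) * e) * bshift m%:~R f
   + bconst (m%:~R * b1) * bdt (bshift m%:~R f)).
Definition omega_U (m : int) f : bipoly K := bconst (lambda ^ m) *
  ((t - bconst (m%:~R * q * alpha)) * bshift (- (m%:~R * q)) f).
Definition omega_V (m : int) f : bipoly K := bconst (lambda ^ m) * bconst b1 * bshift m%:~R f.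

Local Notation A := omega_A.
Local Notation B := omega_B.
Local Notation U := omega_U.
Local Notation V := omega_V.

Let bshD a f g : bshift a (f + g) = bshift a f + bshift a g.
Proof. exact: rmorphD. Qed.
Let bshN a f : bshift a (- f) = - bshift a f.
Proof. exact: rmorphN. Qed.
Let bshM a f g : bshift a (f * g) = bshift a f * bshift a g.
Proof. exact: rmorphM. Qed.
Let bsht a : bshift a t = t. Proof. exact: bshiftp. Qed.
Let bshe a : bshift a e = e. Proof. exact: bshiftp. Qed.
Let bdtD f g : bdt (f + g) = bdt f + bdt g.
Proof. exact: raddfD. Qed.
Let bdtN f : bdt (- f) = - bdt f.
Proof. exact: raddfN. Qed.
Let bdtt : bdt t = 1. Proof. by rewrite bdtp derivX. Qed.
Let bshdt a f : bshift a (bdt f) = bdt (bshift a f).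
Proof. by rewrite bdt_shift. Qed.

Let opE := (bshD, bshN, bshM, bshiftC, bshifts, bsht, bshe, bshdt, bshiftD,
            bdtD, bdtN, bdtM, bdtt, bdtC, bdts).

Hypothesis l0 : lambda != 0.
Let lamD m n : lambda ^ (m + n) = lambda ^ m * lambda ^ n.
Proof. exact: expfzDr. Qed.

Lemma commAA m n f : A m (A n f) - A n (A m f)
  = bconst (q * (n%:~R - m%:~R)) * A (m + n) f.
Proof.
rewrite /omega_A !opE lamD.
have -> : - (n%:~R * q) + - (m%:~R * q) = - ((m + n)%:~R * q) by ring.
have -> : - (m%:~R * q) + - (n%:~R * q) = - ((m + n)%:~R * q) by ring.
move: (bshift _ f) => F.
ring.
Qed.

Lemma commAU m n f : A m (U n f) - U n (A m f)
  = bconst (q * (n%:~R - m%:~R)) * U (m + n) f.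
Proof.
rewrite /omega_A /omega_U !opE lamD.
have -> : - (n%:~R * q) + - (m%:~R * q) = - ((m + n)%:~R * q) by ring.
have -> : - (m%:~R * q) + - (n%:~R * q) = - ((m + n)%:~R * q) by ring.
by move: (bshift _ f) => F; ring.
Qed.

Lemma commUU m n f : U m (U n f) = U n (U m f).
Proof.
by rewrite /omega_U !opE [- (n%:~R * q) + _]addrC; move: (bshift _ f) => F; ring.
Qed.

Lemma commBB m n f : B m (B n f) = B n (B m f).
Proof.
by rewrite /omega_B !opE [n%:~R + _]addrC; move: (bshift _ f) => F; ring.
Qed.

Lemma commBV m n f : B m (V n f) = V n (B m f).
Proof.
by rewrite /omega_B /omega_V !opE [n%:~R + _]addrC; move: (bshift _ f) => F; ring.
Qed.

Lemma commVV m n f : V m (V n f) = V n (V m f).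
Proof.
by rewrite /omega_V !opE [n%:~R + _]addrC; move: (bshift _ f) => F; ring.
Qed.

Lemma commUV m n f : U m (V n f) = V n (U m f).
Proof.
by rewrite /omega_U /omega_V !opE [n%:~R + _]addrC; move: (bshift _ f) => F; ring.
Qed.

Lemma commAB m n f : q = -1 ->
  A m (B n f) - B n (A m f) = - bconst n%:~R * B (m + n) f.
Proof.
move=> q1; rewrite /omega_A /omega_B !opE lamD q1.
have -> : - (m%:~R * -1) + n%:~R = (m + n)%:~R :> K by ring.
have -> : n%:~R + - (m%:~R * -1) = (m + n)%:~R :> K by ring.
by move: (bshift _ f) => F; ring.
Qed.

Lemma commAV m n f : q = -1 ->
  A m (V n f) - V n (A m f) = - bconst n%:~R * V (m + n) f.
Proof.
move=> q1; rewrite /omega_A /omega_V !opE lamD q1.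
have -> : - (m%:~R * -1) + n%:~R = (m + n)%:~R :> K by ring.
have -> : n%:~R + - (m%:~R * -1) = (m + n)%:~R :> K by ring.
by move: (bshift _ f) => F; ring.
Qed.

Lemma commBU m n f : q = -1 ->
  B m (U n f) - U n (B m f) = bconst m%:~R * V (m + n) f.
Proof.
move=> q1; rewrite /omega_B /omega_U /omega_V !opE lamD q1.
have -> : - (n%:~R * -1) + m%:~R = (m + n)%:~R :> K by ring.
have -> : m%:~R + - (n%:~R * -1) = (m + n)%:~R :> K by ring.
by move: (bshift _ f) => F; ring.
Qed.

Let d0 (i : nat) : K := (i == 0%N)%:R.
Let d1 (i : nat) : K := (i == 1%N)%:R * (q == -1)%:R.
Let dz (m : int) (i : nat) : K := (m == 0)%:R * (i%:R == - (2 * q))%:R.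

Let d0D i j : d0 (i + j) = d0 i * d0 j.
Proof. by rewrite /d0 addn_eq0 -natrM mulnb. Qed.

Let d1D i j : d1 (i + j) = d1 i * d0 j + d0 i * d1 j.
Proof.
rewrite /d1 /d0; case: i j => [|[|i]] [|[|j]] //=;
  by rewrite ?addn0 ?add0n ?addnS ?addSn /= ?mul0r ?mul1r ?mulr0 ?mulr1 ?addr0
    ?add0r.
Qed.

Let coef0 m i n j :
  block_coef q m i n j * d0 (i + j) = q * (n%:~R - m%:~R) * (d0 i * d0 j).
Proof.
rewrite d0D /d0 /block_coef; case: i => [|i]; case: j => [|j];
  rewrite ?mul0r ?mulr0 ?mulr1 //=; ring.
Qed.

Let coef1 m i n j : block_coef q m i n j * d1 (i + j) =
  m%:~R * (d1 i * d0 j) - n%:~R * (d0 i * d1 j).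
Proof.
rewrite d1D /d1 /d0 /block_coef; case: (eqVneq q (-1)) => [->|_]; last first.
  by rewrite !mulr0 !mul0r !mulr0 subrr addr0 mulr0.
case: i => [|[|i]]; case: j => [|[|j]]; rewrite ?mul0r ?mulr0 ?mulr1 //=; ring.
Qed.

Let coefz m i n j : block_coef q m i n j * dz (m + n) (i + j) = 0.
Proof.
rewrite /dz; case: (eqVneq (m + n) 0) => [/eqP|_]; last by rewrite mul0r mulr0.
rewrite addr_eq0 => /eqP ->.
case: (eqVneq (i + j)%:R (- (2 * q))) => [|_]; last by rewrite !mulr0.
rewrite natrD => /eqP; rewrite -subr_eq0 => /eqP ij.
rewrite /block_coef mulr1 rmorphN /=.
transitivity (n%:~R * (i%:R + j%:R - - (2 * q))); first by ring.
by rewrite ij mulr0.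
Qed.

Let d1q i : d1 i = 0 \/ q = -1.
Proof. by rewrite /d1; case: (eqVneq q (-1)) => [|_]; [right|left; rewrite mulr0]. Qed.

Variables g1 g2 : K.

Definition omega_L' m i f : bipoly K :=
  bconst (d0 i) * A m f + bconst (d1 i) * B m f + bconst (dz m i * g2) * f.
Definition omega_W' m i f : bipoly K :=
  bconst (d0 i) * U m f + bconst (d1 i) * V m f + bconst (dz m i * g1) * f.

Let lin_op (op : bipoly K -> bipoly K) := forall a b d f1 f2 f3,
  op (bconst a * f1 + bconst b * f2 + bconst d * f3) =
  bconst a * op f1 + bconst b * op f2 + bconst d * op f3.

Let linA m : lin_op (A m).
Proof.
move=> a b d f1 f2 f3; rewrite /omega_A !opE.
by move: (bshift _ f1) (bshift _ f2) (bshift _ f3) => F1 F2 F3; ring.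
Qed.
Let linB m : lin_op (B m).
Proof.
move=> a b d f1 f2 f3; rewrite /omega_B !opE.
by move: (bshift _ f1) (bshift _ f2) (bshift _ f3) => F1 F2 F3; ring.
Qed.
Let linU m : lin_op (U m).
Proof. by move=> a b d f1 f2 f3; rewrite /omega_U !opE; ring. Qed.
Let linV m : lin_op (V m).
Proof. by move=> a b d f1 f2 f3; rewrite /omega_V !opE; ring. Qed.

Let expand (P1 P2 Q1 Q2 : bipoly K -> bipoly K) a1 a2 a3 c1 c2 c3 f :
  lin_op P1 -> lin_op P2 -> lin_op Q1 -> lin_op Q2 ->
  let P f := bconst a1 * P1 f + bconst a2 * P2 f + bconst a3 * f in
  let Q f := bconst c1 * Q1 f + bconst c2 * Q2 f + bconst c3 * f in
  P (Q f) - Q (P f) =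
    bconst (a1 * c1) * (P1 (Q1 f) - Q1 (P1 f))
    + bconst (a1 * c2) * (P1 (Q2 f) - Q2 (P1 f))
    + bconst (a2 * c1) * (P2 (Q1 f) - Q1 (P2 f))
    + bconst (a2 * c2) * (P2 (Q2 f) - Q2 (P2 f)).
Proof. by move=> lP1 lP2 lQ1 lQ2 /=; rewrite lP1 lP2 lQ1 lQ2; ring. Qed.

Let combine (P1 P2 Q1 Q2 : bipoly K -> bipoly K) a1 a2 a3 c1 c2 c3 f
    (k mm nn w e1 e2 e3 : K) (r1 r2 : bipoly K) :
  lin_op P1 -> lin_op P2 -> lin_op Q1 -> lin_op Q2 ->
  P1 (Q1 f) - Q1 (P1 f) = bconst k * r1 ->
  bconst c2 * (P1 (Q2 f) - Q2 (P1 f)) = bconst c2 * (- bconst nn * r2) ->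
  bconst a2 * (P2 (Q1 f) - Q1 (P2 f)) = bconst a2 * (bconst mm * r2) ->
  P2 (Q2 f) = Q2 (P2 f) ->
  w * e1 = k * (a1 * c1) -> w * e2 = mm * (a2 * c1) - nn * (a1 * c2) ->
  w * e3 = 0 ->
  let P f := bconst a1 * P1 f + bconst a2 * P2 f + bconst a3 * f in
  let Q f := bconst c1 * Q1 f + bconst c2 * Q2 f + bconst c3 * f in
  P (Q f) - Q (P f) =
  bconst w * (bconst e1 * r1 + bconst e2 * r2 + bconst e3 * f).
Proof.
move=> lP1 lP2 lQ1 lQ2 h11 h12 h21 h22 ee1 ee2 ee3 P Q; rewrite /P /Q expand //.
rewrite h11 h22 subrr mulr0 addr0.
transitivity (bconst (w * e1) * r1 + bconst (w * e2) * r2 + bconst (w * e3) * f);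
  last by ring.
rewrite ee1 ee2 ee3.
transitivity (bconst a1 * bconst c1 * (bconst k * r1)
  + bconst a1 * (bconst c2 * (P1 (Q2 f) - Q2 (P1 f)))
  + bconst c1 * (bconst a2 * (P2 (Q1 f) - Q1 (P2 f)))); first by ring.
by rewrite h12 h21 rmorph0; ring.
Qed.

Let commAB' m n i f : bconst (d1 i) * (A m (B n f) - B n (A m f)) =
  bconst (d1 i) * (- bconst n%:~R * B (m + n) f).
Proof. by case: (d1q i) => [->|/commAB ->//]; rewrite rmorph0 !mul0r. Qed.
Let commAV' m n i f : bconst (d1 i) * (A m (V n f) - V n (A m f)) =
  bconst (d1 i) * (- bconst n%:~R * V (m + n) f).
Proof. by case: (d1q i) => [->|/commAV ->//]; rewrite rmorph0 !mul0r. Qed.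
Let commBU' m n i f : bconst (d1 i) * (B m (U n f) - U n (B m f)) =
  bconst (d1 i) * (bconst m%:~R * V (m + n) f).
Proof. by case: (d1q i) => [->|/commBU ->//]; rewrite rmorph0 !mul0r. Qed.
Let commBA' m n i f : bconst (d1 i) * (B m (A n f) - A n (B m f)) =
  bconst (d1 i) * (bconst m%:~R * B (m + n) f).
Proof.
case: (d1q i) => [->|q1]; first by rewrite rmorph0 !mul0r.
by rewrite -[X in _ * X = _]opprB (commAB n m f q1) mulNr opprK (addrC n m).
Qed.

Lemma omega_LL m i n j f :
  omega_L' m i (omega_L' n j f) - omega_L' n j (omega_L' m i f) =
  bconst (block_coef q m i n j) * omega_L' (m + n) (i + j) f.
Proof.
apply: (combine _ _ (linA m) (linB m) (linA n) (linB n) (commAA m n f)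
  (commAB' m n j f) (commBA' m n i f) (commBB m n f) (coef0 m i n j)
  (coef1 m i n j)).
by rewrite mulrA coefz mul0r.
Qed.

Lemma omega_LW m i n j f :
  omega_L' m i (omega_W' n j f) - omega_W' n j (omega_L' m i f) =
  bconst (block_coef q m i n j) * omega_W' (m + n) (i + j) f.
Proof.
apply: (combine _ _ (linA m) (linB m) (linU n) (linV n) (commAU m n f)
  (commAV' m n j f) (commBU' m n i f) (commBV m n f) (coef0 m i n j)
  (coef1 m i n j)).
by rewrite mulrA coefz mul0r.
Qed.

Lemma omega_WW m i n j f :
  omega_W' m i (omega_W' n j f) - omega_W' n j (omega_W' m i f) = 0.
Proof.
rewrite /omega_W' (expand _ _ _ _ _ _ _ (linU m) (linV m) (linU n) (linV n)).
have H1 : U m (U n f) - U n (U m f) = 0 by rewrite [X in X - _]commUU subrr.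
have H2 : V m (V n f) - V n (V m f) = 0 by rewrite [X in X - _]commVV subrr.
have H3 : U m (V n f) - V n (U m f) = 0 by rewrite [X in X - _]commUV subrr.
have H4 : V m (U n f) - U n (V m f) = 0 by rewrite -[X in X - _]commUV subrr.
by rewrite H1 H2 H3 H4 !mulr0 !addr0.
Qed.

Let lin_form (P1 P2 : bipoly K -> bipoly K) a1 a2 a3 :
  lin_op P1 -> lin_op P2 ->
  linear (fun f => bconst a1 * P1 f + bconst a2 * P2 f + bconst a3 * f).
Proof.
move=> l1 l2 a f1 f2; rewrite !bscaleE.
have -> : bconst a * f1 + f2 = bconst a * f1 + bconst 1 * f2 + bconst 0 * 0.
  by rewrite rmorph1 mul1r mulr0 addr0.
by rewrite l1 l2; ring.
Qed.

Lemma omega_L'_lin m i : linear (omega_L' m i).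
Proof. exact: lin_form (linA m) (linB m). Qed.

Lemma omega_W'_lin m i : linear (omega_W' m i).
Proof. exact: lin_form (linU m) (linV m). Qed.

End OmegaOps.

Section Omega.
Variables (K : numFieldType) (q lambda alpha : K) (beta gamma : K * K).
Variable h : int -> {poly K}.
Implicit Types f : bipoly K.

Definition omega_L (m : int) (i : nat) f : bipoly K :=
  (i == 0%N)%:R *: (lambda ^ m *:
     ((bs + bpoly (q *: (h m \Po (q^-1 *: 'X)))) * bshift (- (m%:~R * q)) f))
  - (i == 0%N)%:R *: ((m%:~R * lambda ^ m * q) *:
     (bpoly ('X - (m%:~R * q * alpha)%:P) * bdt (bshift (- (m%:~R * q)) f)))
  + ((m == 0)%:R * (i%:R == - (2 * q))%:R * gamma.2) *: f
  + ((i == 1%N)%:R * (q == -1)%:R) *: (lambda ^ m *: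
     (bpoly (beta.2%:P + m%:~R *: Theta alpha h beta.1) * bshift m%:~R f
      + (m%:~R * beta.1) *: bdt (bshift m%:~R f))).

Definition omega_W (m : int) (i : nat) f : bipoly K :=
  (i == 0%N)%:R *: (lambda ^ m *:
     (bpoly ('X - (m%:~R * q * alpha)%:P) * bshift (- (m%:~R * q)) f))
  + ((m == 0)%:R * (i%:R == - (2 * q))%:R * gamma.1) *: f
  + ((i == 1%N)%:R * (q == -1)%:R) *: ((beta.1 * lambda ^ m) *: bshift m%:~R f).

Definition omega_basis (b : block_index) f : bipoly K :=
  match b with
  | Lb m i => omega_L m i f
  | Wb m i => omega_W m i f
  | C1b | C2b => 0
  end.

Definition omega_act (x : Block q) f : bipoly K :=
  linext (fun b => omega_basis b f) x.


Hypotheses (q0 : q != 0) (l0 : lambda != 0) (hT : calT alpha h).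

Let ops_ex : exists (c : K) (E : {poly K}),
  (forall m, bpoly (q *: (h m \Po (q^-1 *: 'X)))
     = bconst m%:~R * (bconst c
         + (bpoly 'X - bconst (m%:~R * q * alpha)) * bpoly E))
  /\ (q = -1 -> Theta alpha h beta.1 = beta.1 *: E).
Proof.
have [c [D hE]] := calT_factor hT.
exists (q * c), (D \Po (q^-1 *: 'X)); split=> [m|q1].
  set G := D \Po _.
  have -> : q *: (h m \Po (q^-1 *: 'X)) =
      m%:~R *: ((q * c)%:P + ('X - (m%:~R * q * alpha)%:P) * G).
    rewrite hE comp_polyZ comp_polyD comp_polyM comp_polyB comp_polyX !comp_polyC.
    rewrite -/G -!mul_polyC.
    transitivity (m%:~R%:P * ((q * c)%:P
       + ((q * q^-1)%:P * 'X - (m%:~R * q * alpha)%:P) * G)); first by ring.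
    by rewrite divff // mul1r.
  by rewrite -mul_polyC -!bpolyC; ring.
rewrite /Theta; congr (_ *: _).
have -> : h 1 \Po (- 'X) - (h 1).[alpha]%:P
    = (D \Po (q^-1 *: 'X)) * (- 'X - alpha%:P).
  rewrite q1 invrN1 scaleN1r hE scale1r mul1r !hornerE subrr mul0r addr0.
  rewrite comp_polyD comp_polyM comp_polyB comp_polyX !comp_polyC.
  by ring.
apply: mulpK; rewrite -opprD oppr_eq0 -[alpha]opprK polyCN.
by rewrite polyXsubC_eq0.
Qed.

Let ops_eq : exists (c : K) (E : {poly K}),
  (forall m i, omega_L m i
     =1 omega_L' q lambda alpha beta.1 beta.2 c E gamma.2 m i)
  /\ (forall m i, omega_W m i =1 omega_W' q lambda alpha beta.1 gamma.1 m i).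
Proof.
have [c [E [hE TE]]] := ops_ex; exists c, E; split=> m i f.
  rewrite /omega_L /omega_L' /omega_A /omega_B hE !bscaleE.
  move: (bshift (- (m%:~R * q)) f) (bshift m%:~R f) => F1 F2.
  have -> : bpoly ('X - (m%:~R * q * alpha)%:P)
      = bpoly 'X - bconst (m%:~R * q * alpha) by rewrite -bpolyC; ring.
  case: (eqVneq q (-1)) => [q1|_]; last by rewrite !mulr0 rmorph0; ring.
  rewrite (TE q1).
  have -> : bpoly (beta.2%:P + m%:~R *: (beta.1 *: E))
      = bconst beta.2 + bconst (m%:~R * beta.1) * bpoly E.
    by rewrite scalerA -mul_polyC -!bpolyC; ring.
  by ring.
rewrite /omega_W /omega_W' /omega_U /omega_V !bscaleE.
move: (bshift (- (m%:~R * q)) f) (bshift m%:~R f) => F1 F2.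
have -> : bpoly ('X - (m%:~R * q * alpha)%:P)
    = bpoly 'X - bconst (m%:~R * q * alpha) by rewrite -bpolyC; ring.
by ring.
Qed.

Lemma omega_basis_linear b : linear (omega_basis b).
Proof.
have [c [E [LE WE]]] := ops_eq.
case: b => [m i|m i||] a f g /=; last 2 first.
- by rewrite scaler0 addr0.
- by rewrite scaler0 addr0.
- by rewrite !LE omega_L'_lin.
- by rewrite !WE omega_W'_lin.
Qed.

Lemma omega_act_linearl f : linear (fun x => omega_act x f).
Proof. exact: linext_linear. Qed.

Lemma omega_act_linearr x : linear (omega_act x).
Proof.
move=> a f g; rewrite /omega_act -linext_linearF; apply: eq_linext => b.
exact: omega_basis_linear.
Qed.

Lemma omega_basis_lie a b f : omega_act (block_bracket q a b) f
  = omega_basis a (omega_basis b f) - omega_basis b (omega_basis a f).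
Proof.
have [c [E [LE WE]]] := ops_eq.
have act0 : omega_act 0 f = 0 by rewrite /omega_act linear0.
have actU d : omega_act (bvec K d) f = omega_basis d f by exact: linextU.
have actB e d e' d' : omega_act (e *: bvec K d + e' *: bvec K d') f
    = e *: omega_basis d f + e' *: omega_basis d' f.
  rewrite omega_act_linearl actU -[e' *: bvec K d']addr0 omega_act_linearl.
  by rewrite actU act0 addr0.
have basis0 d : omega_basis d 0 = 0.
  have := omega_basis_linear d (-1) 0 0.
  by rewrite scaler0 addr0 scaleN1r addNr.
have L0 m i : omega_L m i 0 = 0 by exact: basis0 (Lb m i).
have W0 m i : omega_W m i 0 = 0 by exact: basis0 (Wb m i).
have actN x : omega_act (- x) f = - omega_act x f.
  by rewrite -[- x]addr0 -scaleN1r omega_act_linearl act0 addr0 scaleN1r.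
case: a b => [m i|m i||] [n j|n j||] /=;
  rewrite ?L0 ?W0 ?subr0 ?oppr0 ?act0 //.
- by rewrite actB /= scaler0 addr0 !LE omega_LL.
- by rewrite actB /= scaler0 addr0 !LE !WE omega_LW.
- transitivity (- omega_act (block_bracket q (Lb n j) (Wb m i)) f).
    exact: actN.
  by rewrite /= actB /= scaler0 addr0 !LE !WE -[RHS]opprB omega_LW.
- by rewrite !WE omega_WW.
Qed.

Lemma omega_act_lie (x y : Block q) f : omega_act (lie x y) f
  = omega_act x (omega_act y f) - omega_act y (omega_act x f).
Proof.
have subZ d (P P' Q Q' : bipoly K) :
    d *: P + P' - (d *: Q + Q') = d *: (P - Q) + (P' - Q').
  by rewrite scalerBr opprD addrACA.
move: x; apply: malg_lin_eq => [d u v|d u v|a].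
- by rewrite -omega_act_linearl -block_lie_linl.
- by rewrite !omega_act_linearl omega_act_linearr subZ.
move: y; apply: malg_lin_eq => [d u v|d u v|b].
- by rewrite -omega_act_linearl -block_lie_linr.
- by rewrite !omega_act_linearl omega_act_linearr subZ.
have actU d g : omega_act (bvec K d) g = omega_basis d g by exact: linextU.
by rewrite !actU -omega_basis_lie -block_lieU.
Qed.

Definition Omega : lieModule (Block q) :=
  LieModule omega_act_linearl omega_act_linearr omega_act_lie.

End Omega.

Arguments Omega {K} q lambda alpha beta gamma h q0 l0 hT.

(* Main.v *)
(** [W_{0,0}] and [L_{0,0}] act as multiplication by [t] and [s], so that
    submodules are ideals of [C[t,s]]. For [f] in a submodule [N], the action of
    [W_{1,0}] gives [(t - q alpha) (f(t,s-q) - f(t,s))] in [N], which has smaller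
    degree in [s]; hence a nonzero [N] contains a nonzero [g] in [C[t]]. If
    [alpha != 0], comparing [L_{1,0}] and [L_{-1,0}] on [g] gives
    [2 q alpha g'] in [N]; if [q = -1] and [beta_1 != 0], [L_{1,1}] gives
    [beta_1 g'] in [N]. Either way [N] contains a nonzero constant. In the
    remaining case the ideal generated by [t] is a submodule. *)

Require Import Defs.
From mathcomp Require Import all_boot all_order all_algebra.
From mathcomp Require Import ring.
From mathcomp Require boolp.
From mathcomp Require Import complex reals.

Import GRing.Theory Num.Theory.
Local Open Scope ring_scope.

(** * Difference operators on polynomials over an integral domain *)

Section Difference.
Variables (R : idomainType) (a : R).
Implicit Type f : {poly R}.

(** Substituting the monic linear polynomial ['X + a%:P] keeps the size and the leading coefficient,
    so the top terms cancel. *)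
Lemma size_shift_sub f : f != 0 ->
  (size (f \Po ('X + a%:P) - f)%R < size f)%N.
Proof.
move=> f0; have sX : size ('X + a%:P) = 2%N := size_XaddC a.
have sf : size (f \Po ('X + a%:P)) = size f by apply: size_comp_poly2.
rewrite -(prednK (_ : 0 < size f)%N) ?ltnS ?lt0n ?size_poly_eq0 //.
apply/leq_sizeP => j; rewrite leq_eqVlt => /predU1P[<-|lt_j].
  rewrite coefB -{1}sf -!lead_coefE lead_coef_comp ?sX // lead_coefXaddC.
  by rewrite expr1n mulr1 subrr.
rewrite coefB !nth_default ?subrr ?sf //; exact: leq_trans (leqSpred _) lt_j.
Qed.

Hypotheses (R0 : [pchar R] =i pred0) (a0 : a != 0).

(** A shift-invariant [f] takes the value [f.[0]] at every multiple of [a]. These are distinct in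
    characteristic 0, so the nonzero polynomial [f - f.[0]%:P] would have [size f] roots, more than
    its degree. *)
Lemma shift_sub_neq0 f : (1 < size f)%N -> f \Po ('X + a%:P) - f != 0.
Proof.
move=> f1; apply/eqP => /eqP; rewrite subr_eq0 => /eqP fE.
have fn n : f.[a *+ n] = f.[0].
  elim: n => // n <-.
  by rewrite -{2}fE horner_comp !hornerE mulrSr.
pose rs := [seq a *+ n | n <- iota 0 (size f)].
have g0 : f - f.[0]%:P != 0.
  by rewrite subr_eq0; apply: contraTneq f1 => ->; rewrite -leqNgt size_polyC_leq1.
have := max_poly_roots g0 (_ : all (root _) rs) (_ : uniq rs).
rewrite size_map size_iota => H; suff : (size f < size f)%N by rewrite ltnn.
apply: leq_trans (H _ _) _.
- by apply/allP => x /mapP[n _ ->]; rewrite /root !hornerE fn subrr.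
- rewrite map_inj_uniq ?iota_uniq // => m n /eqP.
  wlog mn : m n / (m <= n)%N.
    by move=> W; case/orP: (leq_total m n) => mn e; [|symmetry]; apply: W => //;
      rewrite eq_sym.
  rewrite eq_sym -subr_eq0 -mulrnBr // -mulr_natr mulf_eq0 (negPf a0).
  by rewrite ((pcharf0P R).1 R0) subn_eq0 => nm; apply/eqP; rewrite eqn_leq mn.
- by rewrite (leq_trans (size_polyD _ _)) // geq_max leqnn size_polyN
    (leq_trans (size_polyC_leq1 _)) // ltnW.
Qed.

End Difference.

Lemma bshift0 (K : fieldType) (f : bipoly K) : bshift 0 f = f.
Proof. by rewrite /bshift !polyC0 addr0 comp_polyXr. Qed.

(** * The action of the basis elements on [Omega] *)

Section Submodules.
Set Implicit Arguments.
Unset Strict Implicit.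
Variables (K : numFieldType) (q lambda alpha : K) (beta gamma : K * K).
Variable h : int -> {poly K}.
Hypotheses (q0 : q != 0) (l0 : lambda != 0) (hT : calT alpha h).

Local Notation Om := (Omega q lambda alpha beta gamma h q0 l0 hT).
Local Notation omegaL := (omega_L q lambda alpha beta gamma h).
Local Notation omegaW := (omega_W q lambda alpha beta gamma).

(** Every action is a finite linear combination of actions of basis elements, and the central ones
    act by 0. *)
Lemma submodule_omegaP (N : bipoly K -> Prop) :
  submodule (M := Om) N <->
  [/\ N 0, forall u v, N u -> N v -> N (u + v),
      forall c v, N v -> N (c *: v) &
      forall m i v, N v -> N (omegaL m i v) /\ N (omegaW m i v)].
Proof.
split=> [[N0 ND NZ Na]|[N0 ND NZ Na]]; split=> //.
- move=> m i v Nv; split.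
    have := Na (bvec K (Lb m i)) v Nv; rewrite /= /omega_act linextU; exact.
  have := Na (bvec K (Wb m i)) v Nv; rewrite /= /omega_act linextU; exact.
- move=> x v Nv; rewrite /= /omega_act linext.unlock.
  apply: big_ind => // b _; apply: NZ.
  by case: b => [m i|m i||] //=; case: (Na m i v Nv).
Qed.

Lemma omegaL00 f : omegaL 0 0 f = bs * f.
Proof.
(* The factor [m%:~R] in this form of [h m] gives [h 0 = 0]. *)
have [c [D hE]] := calT_factor hT.
(* The [gamma] term lives at [i = -2q], which is not 0. *)
have q20 : (0%:R == - (2 * q) :> K) = false.
  by rewrite eq_sym oppr_eq0 mulf_eq0 (negPf q0) pnatr_eq0.
rewrite /omega_L hE eqxx q20 !bscaleE /= expr0z !(mul0r, mulr0) ?oppr0.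
rewrite [bshift _ _]bshift0.
rewrite scale0r comp_poly0 scaler0.
by rewrite !rmorph1 !rmorph0; ring.
Qed.

Lemma omegaW_0 m f : omegaW m 0 f = lambda ^ m *:
  (bpoly ('X - (m%:~R * q * alpha)%:P) * bshift (- (m%:~R * q)) f).
Proof.
have q20 : (0%:R == - (2 * q) :> K) = false.
  by rewrite eq_sym oppr_eq0 mulf_eq0 (negPf q0) pnatr_eq0.
by rewrite /omega_W eqxx q20 /= !(mul0r, mulr0) !scale0r !addr0 scale1r.
Qed.

Lemma omegaW00 f : omegaW 0 0 f = bpoly 'X * f.
Proof.
rewrite omegaW_0 expr0z scale1r !mul0r polyC0 subr0 oppr0.
by rewrite [bshift _ _]bshift0.
Qed.

(** Shifts in [s] fix polynomials in [t], and [m != 0] removes the [gamma] term. *)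
Lemma omegaL_0_bpoly m p : m != 0 -> omegaL m 0 (bpoly p) =
  lambda ^ m *: ((bs + bpoly (q *: (h m \Po (q^-1 *: 'X)))) * bpoly p)
  - (m%:~R * lambda ^ m * q) *:
      bpoly (('X - (m%:~R * q * alpha)%:P) * p^`()).
Proof.
move=> m0; rewrite /omega_L eqxx (negPf m0) /= !mul0r !scale0r !addr0 !scale1r.
by rewrite bshiftp bdtp -(rmorphM (bpoly (K:=K))).
Qed.

Lemma omegaL_1_bpoly m p : q = -1 -> m != 0 -> omegaL m 1 (bpoly p) =
  lambda ^ m *: (bpoly ((beta.2%:P + m%:~R *: Theta alpha h beta.1) * p)
                 + (m%:~R * beta.1) *: bpoly p^`()).
Proof.
move=> q1 m0; rewrite /omega_L (negPf m0) q1 eqxx /= mul1r !mul0r !scale0r.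
by rewrite subrr !add0r eqxx scale1r bshiftp bdtp -(rmorphM (bpoly (K:=K))).
Qed.

(** * Submodules as ideals closed under differentiation in [t] *)

Section Ideal.
Variable N : bipoly K -> Prop.
Hypothesis subN : submodule (M := Om) N.

Let N0 : N 0. Proof. by case: subN. Qed.
Let ND u v : N u -> N v -> N (u + v). Proof. by case: subN => _ H _ _; apply: H. Qed.
Let NZ c v : N v -> N (c *: v). Proof. by case: subN => _ _ H _; apply: H. Qed.
Let NB u v : N u -> N v -> N (u - v).
Proof. by move=> Nu Nv; rewrite -scaleN1r; apply/ND/NZ. Qed.
Let NL m i v : N v -> N (omegaL m i v).
Proof. by case/submodule_omegaP: subN => _ _ _ H /(H m i)[]. Qed.
Let NW m i v : N v -> N (omegaW m i v).
Proof. by case/submodule_omegaP: subN => _ _ _ H /(H m i)[]. Qed.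
Let NZ_cancel c v : c != 0 -> N (c *: v) -> N v.
Proof. by move=> c0 /(NZ c^-1); rewrite scalerA mulVf // scale1r. Qed.

Lemma submodule_ideal g f : N f -> N (g * f).
Proof.
(* Multipliers in [t] alone come first; they serve as coefficients in the induction on powers of
   [s]. *)
move=> Nf; have Np p v : N v -> N (bpoly p * v).
  move=> Nv; elim/poly_ind: p => [|p c IH]; first by rewrite rmorph0 mul0r.
  rewrite rmorphD rmorphM /= mulrDl; apply: ND; last exact: NZ.
  by have := NW 0 0 IH; rewrite omegaW00 mulrA [bpoly 'X * _]mulrC.
elim/poly_ind: g => [|g p IH]; first by rewrite mul0r.
rewrite mulrDl; apply: ND; last exact: Np.
by rewrite -mulrA mulrCA; have := NL 0 0 IH; rewrite omegaL00.
Qed.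

Lemma submodule_bpoly_ex f : N f -> f != 0 ->
  exists2 p : {poly K}, p != 0 & N (bpoly p).
Proof.
have [n] := ubnP (size (f : {poly {poly K}})); elim: n f => // n IH f.
rewrite ltnS => fn Nf f0; have [f1|f1] := leqP (size (f : {poly {poly K}})) 1.
  have fE := size1_polyC f1; exists (f : {poly {poly K}})`_0.
    by apply: contraNneq f0 => f00; rewrite fE f00.
  by rewrite /bpoly -fE.
pose u : {poly K} := 'X - (q * alpha)%:P.
pose d : bipoly K := bshift (- q) f - f.
have u0 : u != 0 by rewrite polyXsubC_eq0.
(* The difference lemmas are applied over the domain [{poly K}], where the shift is a constant
   polynomial. *)
have aq : (- q)%:P != 0 :> {poly K} by rewrite polyC_eq0 oppr_eq0.
have d0 : d != 0.
  apply: (shift_sub_neq0 _ _ _ aq _ f1) => p.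
  by rewrite pchar_poly pchar_num.
apply: (IH (bpoly u * d)).
(* The factor [u] is free of [s], so it does not raise the degree in [s]. *)
- rewrite [size _]size_Cmul //; apply: leq_trans fn.
  exact: size_shift_sub.
- rewrite mulrBr; apply: NB; last exact: submodule_ideal.
  have := NW 1 0 Nf; rewrite omegaW_0 !mul1r; apply: NZ_cancel.
  by rewrite expfz_neq0.
- by rewrite mulf_neq0 // polyC_eq0.
Qed.

Lemma submodule_deriv p : alpha != 0 \/ (q = -1 /\ beta.1 != 0) ->
  N (bpoly p) -> N (bpoly p^`()).
Proof.
case=> [a0|[q1 b0]] Np; last first.
  (* Up to a scalar, this action is a multiple of [p], which lies in [N], plus [beta.1] times the
     derivative. *)
  have := NL 1 1 Np; rewrite omegaL_1_bpoly // => /NZ_cancel.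
  rewrite expfz_neq0 // => /(_ isT) /NB /(_ _).
  move=> /(_ (bpoly ((beta.2%:P + 1%:~R *: Theta alpha h beta.1) * p))).
  rewrite addrAC subrr add0r mul1r rmorphM => /(_ (submodule_ideal _ Np)).
  exact: NZ_cancel.
(* The [s] and [h] terms of [L_{m,0}] multiply [p], so they stay in [N] and can be subtracted
   off. *)
have Nm m : m != 0 -> N (bpoly (('X - (m%:~R * q * alpha)%:P) * p^`())).
  move=> m0; apply: (@NZ_cancel (m%:~R * lambda ^ m * q)).
    by rewrite !mulf_neq0 ?expfz_neq0 // intr_eq0.
  have := NB (NZ (lambda ^ m) (submodule_ideal
    (bs + bpoly (q *: (h m \Po (q^-1 *: 'X)))) Np)) (NL m 0 Np).
  by rewrite omegaL_0_bpoly // opprB addrC subrK.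
(* Here [(t + q alpha) - (t - q alpha) = 2 q alpha] isolates the derivative. *)
have := NB (Nm (-1) isT) (Nm 1 isT).
have c0 : 2 * q * alpha != 0 by rewrite !mulf_neq0 // pnatr_eq0.
rewrite -rmorphB -mulrBl => H; apply: (NZ_cancel c0).
rewrite bscaleE -bpolyC -rmorphM; congr (N (bpoly (_ * _))): H.
by rewrite /= !rmorphN !rmorphM /= !rmorph1; ring.
Qed.

Lemma submodule_full p : alpha != 0 \/ (q = -1 /\ beta.1 != 0) ->
  p != 0 -> N (bpoly p) -> forall f, N f.
Proof.
move=> ab; have [n] := ubnP (size p); elim: n p => // n IH p.
rewrite ltnS => pn p0 Np f; have [p1|p1] := leqP (size p) 1.
  have pE := size1_polyC p1.
  have c0 : p`_0 != 0 by move: p0; rewrite {1}pE polyC_eq0.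
  suff N1 : N 1 by rewrite -[f]mulr1; apply: submodule_ideal.
  apply: (NZ_cancel c0); rewrite bscaleE mulr1 -bpolyC -pE //.
have p'n : (size p^`() < n)%N by apply: leq_trans pn; apply: lt_size_deriv.
apply: (IH _ p'n _ (submodule_deriv ab Np)).
(* The coefficient of index [k] in the derivative is [k.+1] times the leading coefficient of [p],
   hence nonzero. *)
have [k pk] : exists k, size p = k.+2.
  by case: (size p) p1 => [|[|k]] // _; exists k.
have := lead_coef_eq0 p; rewrite lead_coefE pk (negPf p0) /= => lc.
apply/eqP => /polyP/(_ k)/eqP.
by rewrite coef_deriv coef0 -mulr_natr mulf_eq0 lc pnatr_eq0.
Qed.

End Ideal.

(** Differentiating [t g] loses the factor [t]. For [alpha = 0] the derivative in [L_{m,0}] is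
    multiplied by [t] again, and the one in [L_{m,1}] has coefficient 0. *)
Lemma submodule_mul_t : alpha = 0 -> (q = -1 -> beta.1 = 0) ->
  submodule (M := Om) (fun f : bipoly K => exists g, f = bpoly 'X * g).
Proof.
move=> a0 b0; apply/submodule_omegaP; split.
- by exists 0; rewrite mulr0.
- by move=> _ _ [g ->] [g' ->]; exists (g + g'); rewrite mulrDr.
- by move=> c _ [g ->]; exists (c *: g); rewrite !bscaleE mulrCA.
move=> m i _ [g ->]; rewrite /omega_L /omega_W a0 mulr0 subr0.
rewrite !rmorphM /= !bshiftp !bdtM !bdtp derivX rmorph1 !mul1r !bscaleE.
move: (bshift _ g) (bshift _ g) => g1 g2.
set H := bpoly (q *: _); set T := bpoly (_ + _).
set c := bconst ((i == 1%N)%:R * _); set e := bconst (m%:~R * beta.1).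
have ce0 : c * e = 0.
  rewrite /c /e; case: (eqVneq q (-1)) => [/b0 ->|_].
    by rewrite mulr0 rmorph0 mulr0.
  by rewrite mulr0 rmorph0 mul0r.
set d := bconst (i == 0%N)%:R; set l := bconst (lambda ^ m).
set l' := bconst (m%:~R * _ * q); set l'' := bconst (beta.1 * _).
set c1 := bconst (_ * gamma.1); set c2 := bconst (_ * gamma.2); split.
  (* The witness is the image with one [t] divided out, after dropping the term in [c * e]. *)
  exists (d * (l * ((bs + H) * g2)) - d * (l' * (g2 + bpoly 'X * bdt g2))
          + c2 * g + c * (l * (T * g1))).
  transitivity (bpoly 'X * (d * (l * ((bs + H) * g2))
      - d * (l' * (g2 + bpoly 'X * bdt g2)) + c2 * g + c * (l * (T * g1)))
    + c * e * (l * (g1 + bpoly 'X * bdt g1))); first by ring.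
  by rewrite ce0 mul0r addr0.
by exists (d * (l * (bpoly 'X * g2)) + c1 * g + c * (l'' * g1)); ring.
Qed.

End Submodules.

Theorem theorem3p3 (R : realType) (q lambda alpha : R[i])
    (beta gamma : R[i] * R[i]) (h : int -> {poly R[i]})
    (q0 : q != 0) (l0 : lambda != 0) (hT : calT alpha h) :
  simple_module (Omega q lambda alpha beta gamma h q0 l0 hT) <->
  (alpha != 0 \/ (q = -1 /\ beta.1 != 0)).
Proof.
split=> [[_ simp]|ab]; last first.
  split=> [|N subN].
    by exists (1 : bipoly _) => /eqP; rewrite oner_eq0.
  have [[f [Nf f0]]|none] := boolp.pselect (exists f : bipoly R[i], N f /\ f != 0).
    have [p p0 Np] := submodule_bpoly_ex subN Nf f0.
    by right; apply: (submodule_full subN ab p0 Np).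
  left=> v Nv; apply/eqP/negPn/negP => v0; apply: none; by exists v.
have [a0|a0] := eqVneq alpha 0; [right|by left].
have [[-> b0]|no] := boolp.pselect (q = -1 /\ beta.1 != 0); first by [].
have b0 : q = -1 -> beta.1 = 0.
  by move=> q1; apply/eqP/negPn/negP => b0; apply: no.
have [all0|full] := simp _ (submodule_mul_t gamma q0 l0 hT a0 b0).
  have /eqP := all0 (bpoly 'X) (ex_intro _ 1 (esym (mulr1 _))).
  by rewrite polyC_eq0 polyX_eq0.
(* Evaluation at [s = t = 0] separates 1 from the multiples of [t]. *)
have [g /(congr1 (fun f : {poly {poly R[i]}} => (f`_0).[0]))] := full 1.
by rewrite coef1 coefCM !hornerE => /eqP; rewrite ?mul0r oner_eq0.
Qed.
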